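(* Work in the uniform setting described in the context, and assume $f,\alpha,s$ are Hölder continuous on $I^q$ with exponents $\sigma_1,\sigma_2,\sigma_3\in(0,1]$ respectively; put $\sigma=\min\{\sigma_1,\sigma_2,\sigma_3\}$. Let $\overline{\gamma}=\sum_{i\in\{1,\dots,M\}^q}\overline{\alpha}_i$, $\alpha_{\min}=\min_{x\in I^q}|\alpha(x)|$, $\alpha_{\max}=\max_{x\in I^q}|\alpha(x)|$. Then: (i) if $\alpha_{\min}>M^{-\sigma}$, then $q\le\dim_H\mathcal{G}(f^\alpha)\le\underline{\dim}_B\mathcal{G}(f^\alpha)\le\overline{\dim}_B\mathcal{G}(f^\alpha)\le1+\frac{\log\overline{\gamma}}{\log M}$; (ii) if $M^{-\sigma}<\alpha_{\max}<1$, then $q\le\dim_H\mathcal{G}(f^\alpha)\le\underline{\dim}_B\mathcal{G}(f^\alpha)\le\overline{\dim}_B\mathcal{G}(f^\alpha)\le q+1+\frac{\log\alpha_{\max}}{\log M}$; (iii) if $\alpha_{\max}\le M^{-\sigma}$, then $q\le\dim_H\mathcal{G}(f^\alpha)\le\underline{\dim}_B\mathcal{G}(f^\alpha)\le\overline{\dim}_B\mathcal{G}(f^\alpha)\le q+1-\sigma$.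
   Context: Uniform setting: $I=[0,1]$, $q\ge1$, $M\ge2$ an integer, and for every coordinate $k$ the partition is $x_{k,i}=i/M$, $i=0,\dots,M$. The maps $u_{k,i}:I\to[(i-1)/M,i/M]$ are $u_{k,i}(x)=(i-1+x)/M$ for $i$ odd and $u_{k,i}(x)=(i-x)/M$ for $i$ even; for $i=(i_1,\dots,i_q)\in\{1,\dots,M\}^q$, $u_i(y)=(u_{1,i_1}(y_1),\dots,u_{q,i_q}(y_q))$. Functions $f,\alpha,s\in\mathcal{C}(I^q)$ satisfy $\|\alpha\|_\infty<1$ and $s=f$ at the $2^q$ vertices of $I^q$. $f^\alpha$ is the $\alpha$-fractal function: the unique continuous $f^\alpha:I^q\to\mathbb{R}$ with $f^\alpha(x)=f(x)+\alpha(x)[f^\alpha(u_i^{-1}(x))-s(u_i^{-1}(x))]$ for all $i$ and $x\in u_i(I^q)$. $\overline{\alpha}_i=\max\{|\alpha(x)|:x\in u_i(I^q)\}$. $\mathcal{G}(g)=\{(x,g(x)):x\in I^q\}$. $\dim_H$, $\underline{\dim}_B$, $\overline{\dim}_B$ are Hausdorff, lower box and upper box dimension. A function $h$ is Hölder with exponent $\sigma$ if $|h(x)-h(y)|\le K\|x-y\|_2^\sigma$ for some $K>0$ and all $x,y\in I^q$. *)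

(* Defs.v *)
From HB Require Import structures.
From mathcomp Require Import all_boot all_order all_algebra.
From mathcomp Require Import all_classical all_reals all_analysis.
Unset Printing Implicit Defensive.
Import Order.TTheory GRing.Theory Num.Theory.
Local Open Scope classical_set_scope.
Local Open Scope ring_scope.

Section Defs.
Variable R : realType.

Section Dims.
Variables (T : Type) (d : T -> T -> R).

Definition diam (U : set T) : R := sup [set d x y | x in U & y in U].

Definition diam_le (U : set T) (delta : R) : Prop :=
  forall x y, U x -> U y -> d x y <= delta.

Definition diam_pow (s : R) (U : set T) : R :=
  if `[< U = set0 >] then 0 else powR (diam U) s.

Definition delta_cover (delta : R) (F : set T) (U : nat -> set T) : Prop :=
  F `<=` \bigcup_i U i /\ forall i, diam_le (U i) delta.

Definition hausdorff_content (s delta : R) (F : set T) : \bar R :=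
  ereal_inf [set (\sum_(0 <= i <oo) (diam_pow s (U i))%:E)%E
            | U in delta_cover delta F].

(* H^s(F) = lim_{delta -> 0} H^s_delta(F) = sup_{delta > 0} H^s_delta(F)
   (H^s_delta(F) is nonincreasing in delta) *)
Definition hausdorff_measure (s : R) (F : set T) : \bar R :=
  ereal_sup [set hausdorff_content s delta F | delta in `]0, +oo[%classic].

Definition hausdorff_dim (F : set T) : \bar R :=
  ereal_inf [set s%:E | s in [set s : R | 0 <= s /\ hausdorff_measure s F = 0%E]].

Definition covering_number (delta : R) (F : set T) : R :=
  inf [set n%:R | n in [set n : nat | exists U : 'I_n -> set T,
          F `<=` \bigcup_(i in [set: 'I_n]) U i /\ forall i, diam_le (U i) delta]].

Definition box_ratio (F : set T) (delta : R) : R :=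
  ln (covering_number delta F) / (- ln delta).

Definition lower_box_dim (F : set T) : \bar R :=
  ereal_sup [set ereal_inf [set (box_ratio F delta)%:E | delta in `]0, e[%classic]
            | e in `]0, +oo[%classic].

Definition upper_box_dim (F : set T) : \bar R :=
  ereal_inf [set ereal_sup [set (box_ratio F delta)%:E | delta in `]0, e[%classic]
            | e in `]0, +oo[%classic].

End Dims.

Definition vnorm (q : nat) (x : 'I_q -> R) : R := Num.sqrt (\sum_k (x k) ^+ 2).
Definition vdist (q : nat) (x y : 'I_q -> R) : R := vnorm q (fun k => x k - y k).
Definition gdist (q : nat) (p1 p2 : ('I_q -> R) * R) : R :=
  Num.sqrt (\sum_k (p1.1 k - p2.1 k) ^+ 2 + (p1.2 - p2.2) ^+ 2).

Definition cube (q : nat) : set ('I_q -> R) := [set x | forall k, 0 <= x k <= 1].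
Definition vertex (q : nat) : set ('I_q -> R) := [set x | forall k, x k = 0 \/ x k = 1].

Definition graph (q : nat) (g : ('I_q -> R) -> R) : set (('I_q -> R) * R) :=
  [set (x, g x) | x in cube q].

Definition continuous_on_cube (q : nat) (g : ('I_q -> R) -> R) : Prop :=
  forall x, cube q x -> forall e : R, 0 < e -> exists2 del : R, 0 < del &
    forall y, cube q y -> vdist q x y < del -> `|g x - g y| < e.

Definition holder_on_cube (q : nat) (g : ('I_q -> R) -> R) (sig : R) : Prop :=
  exists2 K : R, 0 < K & forall x y, cube q x -> cube q y ->
    `|g x - g y| <= K * powR (vdist q x y) sig.

(** * Uniform setting: partition x_{k,i} = i/M, maps u_{k,i} *)
(* indices i in {1,...,M}: i = j.+1 for j : 'I_M *)
Definition u1 (M : nat) (i : nat) (x : R) : R :=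
  if odd i then (i%:R - 1 + x) / M%:R else (i%:R - x) / M%:R.
Definition u1inv (M : nat) (i : nat) (x : R) : R :=
  if odd i then M%:R * x - (i%:R - 1) else i%:R - M%:R * x.

(* multi-index i = (i_1,...,i_q) in {1..M}^q encoded by j : {ffun 'I_q -> 'I_M},
   i_k = j k + 1 *)
Definition u (q M : nat) (j : {ffun 'I_q -> 'I_M}) (y : 'I_q -> R) : 'I_q -> R :=
  fun k => u1 M (j k).+1 (y k).
Definition uinv (q M : nat) (j : {ffun 'I_q -> 'I_M}) (x : 'I_q -> R) : 'I_q -> R :=
  fun k => u1inv M (j k).+1 (x k).

Definition is_alpha_fractal (q M : nat) (f alpha s fa : ('I_q -> R) -> R) : Prop :=
  continuous_on_cube q fa /\
  forall (j : {ffun 'I_q -> 'I_M}) x, (u q M j @` cube q) x ->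
    fa x = f x + alpha x * (fa (uinv q M j x) - s (uinv q M j x)).

Definition alpha_bar (q M : nat) (alpha : ('I_q -> R) -> R) (j : {ffun 'I_q -> 'I_M}) : R :=
  sup [set `|alpha x| | x in u q M j @` cube q].

Definition alpha_min (q : nat) (alpha : ('I_q -> R) -> R) : R :=
  inf [set `|alpha x| | x in cube q].
Definition alpha_max (q : nat) (alpha : ('I_q -> R) -> R) : R :=
  sup [set `|alpha x| | x in cube q].

End Defs.
Arguments diam {R T} d U.
Arguments diam_le {R T} d U delta.
Arguments diam_pow {R T} d s U.
Arguments delta_cover {R T} d delta F U.
Arguments hausdorff_content {R T} d s delta F.
Arguments hausdorff_measure {R T} d s F.
Arguments hausdorff_dim {R T} d F.
Arguments covering_number {R T} d delta F.
Arguments box_ratio {R T} d F delta.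
Arguments lower_box_dim {R T} d F.
Arguments upper_box_dim {R T} d F.
Arguments vnorm {R} q x.
Arguments vdist {R} q x y.
Arguments gdist {R} q p1 p2.
Arguments cube {R} q _.
Arguments vertex {R} q _.
Arguments graph {R} q g _.
Arguments continuous_on_cube {R} q g.
Arguments holder_on_cube {R} q g sig.
Arguments u1 {R} M i x.
Arguments u1inv {R} M i x.
Arguments u {R} q M j y _.
Arguments uinv {R} q M j x _.
Arguments is_alpha_fractal {R} q M f alpha s fa.
Arguments alpha_bar {R} q M alpha j.
Arguments alpha_min {R} q alpha.
Arguments alpha_max {R} q alpha.

(* Main.v *)
(** The fractal function satisfies [fa (u_j y) = f (u_j y) + alpha (u_j y) * (fa y - s y)],
    so its oscillation over [u_j @` C] is at most [alpha_bar j] times its oscillation over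
    [C], plus [O(M^(-n sig))] if [C] is a cell of side [M^(-n)].  Summing over the
    cells, the total oscillation [V_n] at level [n] satisfies
    [V_(n+1) <= gam * V_n + O((M^q M^(-sig))^n)], whence [V_n = O(n rho^n)] for every [rho]
    that is at least [gam] and [M^(q - sig)].  Slicing each cell into slabs of height
    [M^(-n)] covers the graph by [O(n (M rho)^n)] sets of diameter [O(M^(-n))], so the
    upper box dimension is at most [1 + ln rho / ln M].  The three cases are
    [rho = gam], [rho = M^q alpha_max] and [rho = M^(q - sig)].
    For the lower bound, the graph projects onto the cube without increasing distances,
    and the [q]-th powers of the diameters of a cover of the cube cannot have a small sum. *)
Require Import Defs.
From HB Require Import structures.
From mathcomp Require Import all_boot all_order all_algebra.
From mathcomp Require Import all_classical all_reals all_analysis.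
From mathcomp Require Import lra ring zify.
Import Order.TTheory GRing.Theory Num.Theory.
Import numFieldNormedType.Exports.
Local Open Scope classical_set_scope.
Local Open Scope ring_scope.

(** * Coordinatewise estimates and compactness of the cube *)

Lemma sum_sqr_le (R : realType) (n : nat) (F : 'I_n -> R) (e : R) :
  0 <= e -> (forall k, `|F k| <= e) -> \sum_k F k ^+ 2 <= n%:R * e ^+ 2.
Proof.
move=> e0 Fe; apply: (@le_trans _ _ (\sum_(k < n) e ^+ 2)).
  by apply: ler_sum => k _; rewrite -real_normK ?num_real // lerXn2r ?nnegrE.
by rewrite sumr_const card_ord mulr_natl.
Qed.

Lemma vdist_le (R : realType) (q : nat) (x y : 'I_q -> R) (e : R) :
  0 <= e -> (forall k, `|x k - y k| <= e) -> vdist q x y <= q%:R * e.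
Proof.
move=> e0 xy; rewrite -[leRHS]ger0_norm ?mulr_ge0 // -sqrtr_sqr ler_wsqrtr //.
apply: (le_trans (sum_sqr_le R q (fun k => x k - y k) e e0 xy)).
rewrite exprMn ler_wpM2r ?sqr_ge0 // -natrX ler_nat.
by case: (q) => // m; rewrite leq_pmulr.
Qed.

Lemma gdist_le (R : realType) (q : nat) (p p' : ('I_q -> R) * R) (e : R) :
  0 <= e -> (forall k, `|p.1 k - p'.1 k| <= e) -> `|p.2 - p'.2| <= e ->
  gdist q p p' <= q.+1%:R * e.
Proof.
move=> e0 h1 h2; rewrite -[leRHS]ger0_norm ?mulr_ge0 // -sqrtr_sqr ler_wsqrtr //.
have := sum_sqr_le R q (fun k => p.1 k - p'.1 k) e e0 h1.
have : (p.2 - p'.2) ^+ 2 <= e ^+ 2.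
  by rewrite -real_normK ?num_real // lerXn2r ?nnegrE.
have : q.+1%:R * e ^+ 2 <= (q.+1%:R * e) ^+ 2.
  by rewrite exprMn ler_wpM2r ?sqr_ge0 // -natrX ler_nat leq_pmulr.
by rewrite -[X in X%:R * e ^+ 2 <= _]addn1 natrD mulrDl mul1r; lra.
Qed.

Lemma coord_le_gdist (R : realType) (q : nat) (p p' : ('I_q -> R) * R) (k : 'I_q) :
  `|p.1 k - p'.1 k| <= gdist q p p'.
Proof.
rewrite -sqrtr_sqr ler_wsqrtr // (bigD1 k) //= -addrA lerDl.
by rewrite addr_ge0 ?sqr_ge0 ?sumr_ge0 // => i _; rewrite sqr_ge0.
Qed.

(** Heine-Borel with a radius that varies with the centre: the box of row vectors is compact and its
    balls are sup-norm balls, so a finite subcover transfers to coordinate functions. *)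
Lemma cube_finite_subcover (R : realType) (q : nat) (r : ('I_q -> R) -> R) :
  (forall x, cube q x -> 0 < r x) ->
  exists (n : nat) (p : 'I_n -> 'I_q -> R),
    (forall i, cube q (p i)) /\
    forall y, cube q y -> exists i, forall k, `|p i k - y k| < r (p i).
Proof.
move=> r0.
pose A : set 'rV[R]_q := [set v : 'rV[R]_q | forall i, [set` `[0, 1]] (v ord0 i)].
have cA : compact A.
  by apply: (@rV_compact R q (fun=> [set` `[0, 1]])) => i; exact: segment_compact.
pose g (v : 'rV[R]_q) : 'I_q -> R := fun k => v ord0 k.
have Ag v : A v -> cube q (g v).
  by move=> Av k; have := Av k; rewrite /= in_itv.
move: cA; rewrite compact_cover => /(_ _ A (fun v => interior (ball v (r (g v))))).
case.
- by move=> v _; exact: open_interior.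
- by move=> v Av; exists v => //; exact/nbhsx_ballx/r0/Ag.
move=> D sD cD.
have mD (i : 'I_(size (finmap.enum_fset D))) : nth 0 (finmap.enum_fset D) i \in finmap.enum_fset D by exact: mem_nth.
exists (size (finmap.enum_fset D)), (fun i => g (nth 0 (finmap.enum_fset D) i)); split.
  by move=> i; apply: Ag; have := sD _ (mD i); rewrite inE.
move=> y cy.
have Ay : A (\row_k y k) by move=> k; rewrite /= mxE in_itv /=; exact: cy.
have [v vD /interior_subset vy] := cD _ Ay.
have lv : (index v (finmap.enum_fset D) < size (finmap.enum_fset D))%N by rewrite index_mem.
exists (Ordinal lv) => k /=; rewrite nth_index //.
by have [_ /(_ ord0 k)] := vy; rewrite mxE.
Qed.

Lemma continuous_on_cube_bounded (R : realType) (q : nat) (g : ('I_q -> R) -> R) :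
  continuous_on_cube q g ->
  exists2 B : R, 0 < B & forall x, cube q x -> `|g x| <= B.
Proof.
move=> cg.
have /choice [r hr] : forall x : 'I_q -> R, exists d : R, cube q x -> 0 < d /\
    forall y, cube q y -> (forall k, `|x k - y k| < d) -> `|g x - g y| < 1.
  move=> x; have [cx|ncx] := pselect (cube q x); last by exists 0 => /ncx.
  have [d d0 hd] := cg x cx 1 ltr01.
  (* [vdist] is at most [q] times the coordinatewise bound; dividing by [q.+1] keeps it strictly
     below [d]. *)
  exists (d / q.+1%:R) => _; split; first by rewrite divr_gt0.
  move=> y cy xy; apply: hd => //.
  have /le_lt_trans -> // : vdist q x y <= q%:R * (d / q.+1%:R).
    by apply: vdist_le => [|k]; rewrite ?divr_ge0 ?ltW ?xy // ltW.
  by rewrite mulrCA gtr_pMr // ltr_pdivrMr // mul1r ltr_nat.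
have [|n [p [cp hp]]] := cube_finite_subcover R q r; first by move=> x /hr[].
exists (1 + \sum_i `|g (p i)|).
  by rewrite ltr_wpDr // sumr_ge0.
move=> y cy; have [i hi] := hp y cy.
have [_ /(_ y cy hi) gy] := hr _ (cp i).
have : `|g (p i)| <= \sum_i `|g (p i)| by rewrite (bigD1 i) //= lerDl sumr_ge0.
by have := lerB_dist (g y) (g (p i)); rewrite distrC; lra.
Qed.

(** * Grid counting and the lower bound for the Hausdorff dimension *)

(** Coordinatewise differences to a fixed [v0] in [S] lie between [-w] and [w]; adding [w] before
    subtracting keeps them natural, so they embed [S] into [q]-tuples over [2w + 1] values. *)
Lemma grid_card_le (q N w : nat) (S : {set {ffun 'I_q -> 'I_N}}) :
  (forall v v', v \in S -> v' \in S -> forall k, (v k <= v' k + w)%N) ->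
  (#|S| <= w.*2.+1 ^ q)%N.
Proof.
move=> Sw; have [->|[v0 v0S]] := set_0Vmem S; first by rewrite cards0.
pose h (v : {ffun 'I_q -> 'I_N}) : {ffun 'I_q -> 'I_(w.*2.+1)} :=
  [ffun k => inord (v k + w - v0 k)].
suff hinj : {in S &, injective h}.
  apply: leq_trans (_ : #|{ffun 'I_q -> 'I_(w.*2.+1)}| <= _)%N.
    exact: leq_card_in hinj.
  by rewrite card_ffun !card_ord.
move=> v v' vS v'S /ffunP hvv'; apply/ffunP => k; apply/val_inj => /=.
have := Sw _ _ v0S vS k; have := Sw _ _ v0S v'S k.
have := Sw _ _ vS v0S k; have := Sw _ _ v'S v0S k.
have := congr1 (@nat_of_ord _) (hvv' k); rewrite !ffunE.
move: (nat_of_ord (v k)) (nat_of_ord (v' k)) (nat_of_ord (v0 k)) => a a' a0.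
by move=> + h1 h2 h3 h4; rewrite !inordK; lia.
Qed.

(** Grid points play the role of Lebesgue measure: [B i] holds at most [(2 * N * r i + 1) ^ q] of
    the [N ^ q] points, hence at most [(3 * N * r i) ^ q]. Dividing by [N ^ q] removes the grid. *)
Lemma cube_cover_volume (R : realType) (q n : nat) (B : 'I_n -> set ('I_q -> R))
    (r : 'I_n -> R) :
  (forall i, 0 < r i) -> cube q `<=` \bigcup_i B i ->
  (forall i x y, B i x -> B i y -> forall k, `|x k - y k| <= r i) ->
  1 <= 3 ^+ q * \sum_i r i ^+ q.
Proof.
move=> r0 cB Br.
(* Count the points of the grid [(1/N) Z^q] with [N] so fine that [N r_i >= 1]. *)
pose N := (Num.trunc (\sum_i (r i)^-1)).+1.
have N0 : 0 < N%:R :> R by rewrite ltr0n.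
have Nr i : 1 <= N%:R * r i.
  rewrite -ler_pdivrMr // div1r (@le_trans _ _ (\sum_i (r i)^-1)) //.
    by rewrite (bigD1 i) //= lerDl sumr_ge0 // => j _; rewrite invr_ge0 ltW.
  by rewrite ltW // truncnS_gt.
pose p (v : {ffun 'I_q -> 'I_N}) : 'I_q -> R := fun k => (v k)%:R / N%:R.
pose S i := [set v | `[< B i (p v) >]]%SET.
have cardS i : (#|S i| <= (Num.trunc (N%:R * r i)).*2.+1 ^ q)%N.
  apply: grid_card_le => v v'; rewrite !inE => Bv Bv' k.
  rewrite -leq_subLR truncn_ge_nat ?(le_trans ler01) //.
  have [vv'|/ltnW vv'] := leqP (v k) (v' k).
    by rewrite (eqP vv') (le_trans ler01).
  rewrite natrB // mulrC -ler_pdivrMr // mulrBl.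
  exact: le_trans (ler_norm _) (Br _ _ _ Bv Bv' k).
have cov : (N ^ q <= \sum_i #|S i|)%N.
  have -> : (N ^ q = \sum_(v : {ffun 'I_q -> 'I_N}) 1)%N.
    by rewrite sum1_card card_ffun !card_ord.
  under [leqRHS]eq_bigr do rewrite -sum1_card big_mkcond.
  rewrite exchange_big leq_sum // => v _.
  have [|i _ Bi] := cB (p v).
    move=> k; rewrite divr_ge0 //= ler_pdivrMr // mul1r ler_nat.
    exact/ltnW/ltn_ord.
  by rewrite (bigD1 i) //= inE; case: asboolP.
rewrite -(ler_pM2l (exprn_gt0 q N0)) mulr1.
apply: (@le_trans _ _ (\sum_i #|S i|)%N%:R); first by rewrite -natrX ler_nat.
rewrite natr_sum !mulr_sumr ler_sum // => i _.
rewrite (@le_trans _ _ (((Num.trunc (N%:R * r i)).*2.+1 ^ q)%N%:R)) ?ler_nat //.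
rewrite !natrX mulrCA -!exprMn lerXn2r ?nnegrE //.
  by rewrite !mulr_ge0 // ltW.
have := Nr i; have : (Num.trunc (N%:R * r i))%:R <= N%:R * r i.
  by rewrite truncn_le (le_trans ler01).
by rewrite -muln2 -natr1 natrM; lra.
Qed.

Section Diameter.
Variables (R : realType) (T : Type) (d : T -> T -> R).

(** [diam] is a [sup], so it bounds distances only once [diam_le] makes them bounded. *)
Lemma le_diam (U : set T) (delta : R) (x y : T) :
  diam_le d U delta -> U x -> U y -> d x y <= diam d U.
Proof.
move=> dU Ux Uy; apply: ub_le_sup; last by exists x => //; exists y.
by exists delta => _ [a Ua [b Ub <-]]; exact: dU.
Qed.

Lemma diam_le_diam (U : set T) (delta : R) (x : T) :
  diam_le d U delta -> U x -> diam d U <= delta.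
Proof.
move=> dU Ux; apply: ge_sup; first by exists (d x x); exists x => //; exists x.
by move=> _ [a Ua [b Ub <-]]; exact: dU.
Qed.

Lemma diam_pow_ge0 (s : R) (U : set T) : 0 <= diam_pow d s U.
Proof. by rewrite /diam_pow; case: ifP => // _; exact: powR_ge0. Qed.

End Diameter.

Lemma powR_le_expr (R : realType) (x s : R) (n : nat) :
  0 <= x <= 1 -> s <= n%:R -> (0 < n)%N -> x ^+ n <= x `^ s.
Proof.
move=> /andP[]; rewrite le_eqVlt => /predU1P[<- _ _ n0|x0 x1 sn _].
  by rewrite expr0n gtn_eqF // powR_ge0.
by rewrite -powR_mulrn ?(ltW x0) // ger_powR // x0.
Qed.

(** If the measure vanished for some [s < q], the graph would have a cover by sets of diameter at
    most 1 with a small sum of [s]-th powers. Thickened projections of finitely many of them would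
    cover the cube with too little volume. *)
Lemma hausdorff_dim_graph_ge (R : realType) (q : nat) (g : ('I_q -> R) -> R) :
  (1 <= q)%N -> (q%:R%:E <= hausdorff_dim (gdist q) (graph q g))%E.
Proof.
move=> q1; apply: le_ereal_inf_tmp => _ [s [s0 Hs] <-].
rewrite lee_fin leNgt; apply/negP => /ltW sq.
(* One [3 ^+ q] is the constant of [cube_cover_volume], the other comes from the widths [3 * r i];
   the last 3 turns the final bound [eps + eps] into 2/3. *)
pose eps : R := (3 ^+ q * 3 ^+ q * 3)^-1.
have eps0 : 0 < eps by rewrite invr_gt0 !mulr_gt0 // exprn_gt0.
have eps1 : eps <= 1.
  by rewrite invf_le1 ?mulr_gt0 ?exprn_gt0 // -!exprD -exprSr exprn_ege1 ?ler1n.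
have : (hausdorff_content (gdist q) s 1 (graph q g) < eps%:E)%E.
  apply: (@le_lt_trans _ _ 0%E); last by rewrite lte_fin.
  rewrite -Hs; apply: ereal_sup_ubound; exists 1 => //.
  by rewrite /= in_itv /= andbT.
move=> /ereal_inf_lt[_ [U [cU dU] <-]] sumU.
(* The sets of the cover may be single points, so their diameters are replaced by
   positive radii of summable excess. *)
pose e i : R := eps / 2 ^+ i.+1.
have e0 i : 0 < e i by rewrite divr_gt0 // exprn_gt0.
have e1 i : e i <= 1.
  rewrite ler_pdivrMr ?exprn_gt0 // mul1r (le_trans eps1) //.
  by rewrite exprn_ege1 ?ler1n.
pose r i : R := Num.max (diam (gdist q) (U i)) (e i).
have r0 i : 0 < r i by rewrite lt_max e0 orbT.
have /choice [c hc] : forall x : 'I_q -> R, exists i, cube q x -> U i (x, g x).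
  move=> x; have [cx|ncx] := pselect (cube q x); last by exists 0%N => /ncx.
  by have [|i _ Ui] := cU (x, g x); [exists x | exists i].
have [n [p [cp hp]]] := cube_finite_subcover R q (fun x => r (c x)) (fun x _ => r0 _).
pose m := (\max_i c (p i)).+1.
(* Thickening the projection of [U i] by [r i] makes it contain the ball of radius [r i] about each
   of its points, so finitely many balls suffice; the width becomes at most [3 * r i]. *)
pose B (i : 'I_m) : set ('I_q -> R) := [set y | exists z, U i z /\
  forall k, `|z.1 k - y k| < r i].
have cB : cube q `<=` \bigcup_i B i.
  move=> y cy; have [i hi] := hp y cy.
  have im : (c (p i) < m)%N by rewrite ltnS; exact: leq_bigmax.
  exists (Ordinal im) => //=; exists (p i, g (p i)); split => //=.
  exact: hc.
have rB (i : 'I_m) x y : B i x -> B i y -> forall k, `|x k - y k| <= 3 * r i.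
  move=> [z [Uz zx]] [t [Ut ty]] k.
  have zt : `|z.1 k - t.1 k| <= r i.
    rewrite (le_trans (coord_le_gdist _ _ _ _ _)) // le_max.
    by rewrite (le_diam _ _ _ _ _ _ _ (dU i) Uz Ut).
  move: zt (zx k) (ty k); rewrite !ler_norml !ltr_norml.
  by move=> /andP[? ?] /andP[? ?] /andP[? ?]; apply/andP; split; lra.
have r30 (i : 'I_m) : 0 < 3 * r i by rewrite mulr_gt0.
have := cube_cover_volume R q m B (fun i => 3 * r i) r30 cB rB.
apply/negP; rewrite -ltNge.
under eq_bigr do rewrite exprMn.
rewrite -mulr_sumr mulrA.
(* If the maximum is [e i], then [e i <= 1] is enough. Otherwise the diameter is positive, so [U i]
   is nonempty ([sup] of the empty set is 0), and being at most 1 its [q]-th power is below its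
   [s]-th. *)
have rq i : r i ^+ q <= diam_pow (gdist q) s (U i) + e i.
  rewrite /r; case: (leP (diam _ _)) => [_|eD].
    by apply: ler_wpDl; rewrite ?diam_pow_ge0 // ler_iXnr // ltW.
  apply: ler_wpDr; first exact: ltW.
  rewrite /diam_pow.
  case: asboolP => [U0|/eqP/set0P[z Uz]].
    move: eD; rewrite (_ : diam _ _ = 0) ?ltNge ?(ltW (e0 i)) //.
    rewrite /diam U0 [X in sup X](_ : _ = set0) ?sup0 //.
    by apply/seteqP; split => // _ [? []].
  rewrite powR_le_expr // (diam_le_diam _ _ _ _ _ _ (dU i) Uz) andbT.
  exact: le_trans (ltW (e0 i)) (ltW eD).
have es : \sum_(i < m) e i <= eps.
  suff -> : \sum_(i < m) e i = eps - eps / 2 ^+ m.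
    by rewrite gerBl divr_ge0 ?exprn_ge0 // ltW.
  elim: (m) => [|k IH]; first by rewrite big_ord0 expr0 divr1 subrr.
  rewrite big_ord_recr /= IH /e exprS; field.
  by rewrite expf_neq0.
have ds : \sum_(i < m) diam_pow (gdist q) s (U i) < eps.
  rewrite -lte_fin -sumEFin; apply: le_lt_trans sumU.
  rewrite -(big_mkord xpredT (fun i => (diam_pow (gdist q) s (U i))%:E)).
  by apply: nneseries_lim_ge => i _ _; rewrite lee_fin diam_pow_ge0.
have : \sum_(i < m) r i ^+ q < eps + eps.
  apply: (le_lt_trans (ler_sum _ (fun (i : 'I_m) _ => rq i))).
  by rewrite big_split /= ltr_leD.
rewrite -(ltr_pM2l (_ : 0 < 3 ^+ q * 3 ^+ q)) ?mulr_gt0 ?exprn_gt0 // => /lt_trans; apply.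
rewrite [ltLHS](_ : _ = 2 / 3); first by lra.
by rewrite /eps; field; rewrite expf_neq0.
Qed.

(** * Covering numbers and the comparison of dimensions *)

Section BoxDimension.
Variables (R : realType) (T : Type) (d : T -> T -> R) (F : set T).

Definition finite_cover (delta : R) (n : nat) : Prop :=
  exists U : 'I_n -> set T,
    F `<=` \bigcup_(i in [set: 'I_n]) U i /\ forall i, diam_le d (U i) delta.

Lemma covering_number_le (delta : R) (n : nat) :
  finite_cover delta n -> covering_number d delta F <= n%:R.
Proof.
move=> cn; apply: ge_inf; last by exists n.
by exists 0 => _ [k _ <-].
Qed.

(** The infimum runs over naturals, so a least cover exists as soon as there is one; the hypothesis
    excludes the empty set, whose [inf] is the default 0. *)
Lemma covering_number_attained (delta : R) (n : nat) : finite_cover delta n ->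
  exists2 m, finite_cover delta m & covering_number d delta F = m%:R.
Proof.
move=> cn; have ex : exists m, `[< finite_cover delta m >] by exists n; apply/asboolP.
exists (ex_minn ex); case: ex_minnP => m /asboolP cm mmin //.
apply/eqP; rewrite eq_le covering_number_le //=.
apply: lb_le_inf; first by exists m%:R, m.
by move=> _ [k ck <-]; rewrite ler_nat mmin //; apply/asboolP.
Qed.

Lemma finite_cover_gt0 (delta : R) (n : nat) (x : T) :
  F x -> finite_cover delta n -> (0 < n)%N.
Proof.
by move=> Fx [U [cU _]]; have [i _ _] := cU x Fx; exact: leq_ltn_trans (ltn_ord i).
Qed.

Lemma covering_number_ge1 (delta : R) (n : nat) (x : T) :
  F x -> finite_cover delta n -> 1 <= covering_number d delta F.
Proof.
move=> Fx /covering_number_attained[m cm ->].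
by rewrite ler1n; exact: finite_cover_gt0 Fx cm.
Qed.

Lemma lower_box_dim_le_upper : (lower_box_dim d F <= upper_box_dim d F)%E.
Proof.
apply: ge_ereal_sup => _ [e /= + <-]; rewrite in_itv /= andbT => e0.
apply: le_ereal_inf_tmp => _ [e' /= + <-]; rewrite in_itv /= andbT => e'0.
have m0 : 0 < Num.min e e' by rewrite lt_min e0.
have [me me'] : Num.min e e' / 2 < e /\ Num.min e e' / 2 < e'.
  have h1 : Num.min e e' <= e by rewrite ge_min lexx.
  have h2 : Num.min e e' <= e' by rewrite ge_min lexx orbT.
  by split; lra.
apply: (@le_trans _ _ (box_ratio d F (Num.min e e' / 2))%:E).
  by apply: ereal_inf_lbound; exists (Num.min e e' / 2) => //=; rewrite in_itv /= me divr_gt0.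
by apply: ereal_sup_ubound; exists (Num.min e e' / 2) => //=; rewrite in_itv /= me' divr_gt0.
Qed.

Hypothesis d_ge0 : forall x y, 0 <= d x y.

Lemma hausdorff_content_le (s delta eta : R) (n : nat) :
  0 <= s -> delta <= eta -> finite_cover delta n ->
  (hausdorff_content d s eta F <= (n%:R * delta `^ s)%:E)%E.
Proof.
move=> s0 de [U [cU dU]].
(* Padding with [set0], to which [diam_pow] gives 0 even for [s = 0], turns the finite cover into a
   sequence. *)
pose V i := if insub i is Some j then U j else set0.
apply: (@le_trans _ _ (\sum_(0 <= i <oo) (diam_pow d s (V i))%:E)%E).
  apply: ereal_inf_lbound; exists V => //; split.
    by move=> x /cU[i _ Ui]; exists (val i) => //; rewrite /V valK.
  move=> i x y; rewrite /V; case: insubP => // j _ _ Ujx Ujy.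
  exact: le_trans (dU j _ _ Ujx Ujy) de.
rewrite (nneseries_split 0 n); last by move=> k _; rewrite lee_fin diam_pow_ge0.
rewrite [X in (_ + X)%E]eseries0; last first.
  move=> i; rewrite add0n => ni _; rewrite /V insubF ?ltnNge ?ni //.
  by rewrite /diam_pow asboolT.
rewrite adde0 add0n big_mkord sumEFin lee_fin.
rewrite mulr_natl -[in leRHS](card_ord n) -sumr_const ler_sum // => i _.
rewrite /V valK /diam_pow; case: asboolP => [_|/eqP/set0P[z Uz]].
  exact: powR_ge0.
have dz := diam_le_diam _ _ _ _ _ _ (dU i) Uz.
have z0 : 0 <= diam d (U i).
  exact: le_trans (d_ge0 z z) (le_diam _ _ _ _ _ _ _ (dU i) Uz Uz).
by rewrite ge0_ler_powR // nnegrE // (le_trans z0).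
Qed.

Lemma hausdorff_measure_ge0 (s : R) : (0 <= hausdorff_measure d s F)%E.
Proof.
apply: (@le_trans _ _ (hausdorff_content d s 1 F)).
  apply: le_ereal_inf_tmp => _ [U _ <-].
  by apply: nneseries_ge0 => i _ _; rewrite lee_fin diam_pow_ge0.
by apply: ereal_sup_ubound; exists 1 => //=; rewrite in_itv /= andbT.
Qed.

Hypothesis F_neq0 : F !=set0.
Hypothesis F_cover : forall delta : R, 0 < delta -> exists n, finite_cover delta n.

(** If [l] is the lower box dimension and [k = eps / 2], arbitrarily small [delta] have covering
    number below [delta] to the power [-(l + k)]. The content at exponent [l + eps] is then at most
    [delta] to the power [k], which tends to 0. *)
Lemma hausdorff_dim_le_lower_box : (hausdorff_dim d F <= lower_box_dim d F)%E.
Proof.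
have [x Fx] := F_neq0.
(* Scales below 1 have nonnegative ratios. This excludes [-oo] and gives the sign condition on
   exponents in [hausdorff_dim]. *)
have l0 : (0 <= lower_box_dim d F)%E.
  apply: (@le_trans _ _
    (ereal_inf [set (box_ratio d F delta)%:E | delta in `]0%R, 1%R[%classic])).
    apply: le_ereal_inf_tmp => _ [e /= + <-]; rewrite in_itv /= => /andP[e0 e1].
    have [n cn] := F_cover e e0.
    rewrite lee_fin divr_ge0 //; first by rewrite ln_ge0 // (covering_number_ge1 e n x).
    by rewrite oppr_ge0 ln_le0 // ltW.
  by apply: ereal_sup_ubound; exists 1 => //=; rewrite in_itv /= andbT.
case El : (lower_box_dim d F) l0 => [l| |] // l0; last by rewrite leey.
rewrite lee_fin in l0.
apply/lee_addgt0Pr => eps eps0; rewrite -EFinD.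
apply: ereal_inf_lbound; exists (l + eps) => //; split.
  by rewrite addr_ge0 // ltW.
apply/eqP; rewrite eq_le hausdorff_measure_ge0 andbT.
apply: ge_ereal_sup => _ [d0 /= + <-]; rewrite in_itv /= andbT => d00.
apply/lee_addgt0Pr => eta eta0; rewrite add0e.
pose k := eps / 2.
have k0 : 0 < k by rewrite divr_gt0.
(* The last entry is [eta] to the power [1 / k]: below it, the [k]-th power of [delta] is less than
   [eta]. *)
pose e := Num.min (Num.min d0 1) (expR (ln eta / k)).
have e0 : 0 < e by rewrite !lt_min d00 ltr01 expR_gt0.
have : (ereal_inf [set (box_ratio d F delta)%:E | delta in `]0%R, e[%classic] < (l + k)%:E)%E.
  apply: (@le_lt_trans _ _ l%:E); last by rewrite lte_fin ltrDl.
  by rewrite -El; apply: ereal_sup_ubound; exists e => //=; rewrite in_itv /= andbT.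
move=> /ereal_inf_lt[_ [delta /= + <-]]; rewrite in_itv /= lte_fin => /andP[de0].
rewrite !lt_min => /andP[/andP[dd0 d1] dk].
have [n cn] := F_cover delta de0.
have [m cm Em] := covering_number_attained delta n cn.
have m0 := finite_cover_gt0 delta m x Fx cm.
have ld : ln delta < 0 by rewrite ln_lt0 // de0.
rewrite /box_ratio Em ltr_pdivrMr ?oppr_gt0 // => lm.
apply: (le_trans (hausdorff_content_le _ _ _ _ _ (ltW dd0) cm)).
  by rewrite addr_ge0 // ltW.
rewrite lee_fin -[m%:R]lnK ?posrE ?ltr0n // /powR gt_eqF // -expRD.
rewrite -[leRHS]lnK ?posrE // ler_expR.
have : k * ln delta <= ln eta.
  by rewrite mulrC -ler_pdivlMr // -[leRHS]expRK ler_ln ?posrE ?expR_gt0 // ltW.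
by move: lm; rewrite /k; lra.
Qed.

(** The tangent to the concave [ln] at [1 / k]. Its slope can be made arbitrarily small, which
    absorbs the factor [n.+1] of the covering bounds. *)
Lemma ln_le_linear (y k : R) : 0 < y -> 0 < k -> ln y <= k * y - 1 - ln k.
Proof.
move=> y0 k0; have := @le_ln1Dx R (k * y - 1).
rewrite ltrBrDr addNr mulr_gt0 // => /(_ isT).
by rewrite addrC subrK lnM ?posrE //; lra.
Qed.

(** Geometric scales suffice: [n * L] can be chosen to overshoot [- ln delta + ln c] by at most [L],
    a bounded change of logarithm. Asking for the bound at every larger [delta] puts the
    monotonicity of covering numbers into the hypothesis. *)
Lemma upper_box_dim_le (L D C c : R) : 0 < L -> 0 <= D -> 1 <= C -> 1 <= c ->
  (forall (n : nat) (delta : R), c * expR (- (n%:R * L)) <= delta ->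
     covering_number d delta F <= C * n.+1%:R * expR (n%:R * L * D)) ->
  (upper_box_dim d F <= D%:E)%E.
Proof.
move=> L0 D0 C1 c1 Nle; have [x Fx] := F_neq0.
have C0 : 0 < C by rewrite (lt_le_trans ltr01).
have c0 : 0 < c by rewrite (lt_le_trans ltr01).
apply/lee_addgt0Pr => eta eta0; rewrite -EFinD.
(* As the slope in [ln_le_linear], this makes [k * n] equal to [eta / 2] times [n * L], where
   [n * L] is [- ln delta] up to a constant. *)
pose k := eta * L / 2.
have k0 : 0 < k by rewrite divr_gt0 ?mulr_gt0.
(* The terms free of [delta]: with [t = - ln delta], the logarithm of the covering number is at most
   [(D + eta / 2) * t + C'], and [delta < e] gives [C' <= eta * t / 2]. *)
pose C' := ln C + k - 1 - ln k + (D + eta / 2) * (ln c + L).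
pose e := Num.min 1 (expR (- (2 * C' / eta))).
apply: (@le_trans _ _ (ereal_sup [set (box_ratio d F delta)%:E | delta in `]0%R, e[%classic])).
  apply: ereal_inf_lbound; exists e => //=.
  by rewrite in_itv /= andbT lt_min ltr01 expR_gt0.
apply: ge_ereal_sup => _ [delta /= + <-]; rewrite in_itv /= lt_min.
move=> /andP[de0 /andP[de1 dee]].
have ld : ln delta < 0 by rewrite ln_lt0 // de0.
have [m cm] := F_cover delta de0.
have N1 := covering_number_ge1 delta m x Fx cm.
have N0 := lt_le_trans ltr01 N1.
rewrite lee_fin /box_ratio ler_pdivrMr ?oppr_gt0 //.
set t := - ln delta.
have t0 : 0 < t by rewrite oppr_gt0.
have lc : 0 <= ln c by rewrite ln_ge0.
pose n := (Num.trunc ((t + ln c) / L)).+1.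
have nlo : t + ln c <= n%:R * L by rewrite -ler_pdivrMr // ltW // truncnS_gt.
have nhi : n%:R * L <= t + ln c + L.
  rewrite -natr1 mulrDl mul1r lerD2r -ler_pdivlMr // truncn_le.
  by rewrite divr_ge0 ?addr_ge0 // ltW.
have nd : c * expR (- (n%:R * L)) <= delta.
  rewrite -[X in X * _]lnK ?posrE // -expRD -[leRHS]lnK ?posrE // ler_expR.
  by move: nlo; rewrite /t; lra.
have n0 : 0 < n.+1%:R :> R by rewrite ltr0n.
have lnN : ln (covering_number d delta F) <= ln C + ln n.+1%:R + n%:R * L * D.
  rewrite -[X in _ <= _ + X]expRK -lnM ?posrE // -lnM ?posrE ?mulr_gt0 ?expR_gt0 //.
  by rewrite ler_ln ?posrE ?mulr_gt0 ?expR_gt0 // Nle.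
have lnn := ln_le_linear n.+1%:R k n0 k0.
have tC : 2 * C' <= eta * t.
  rewrite [leRHS]mulrC -ler_pdivrMr // /t lerNr -[leRHS]expRK.
  by rewrite ler_ln ?posrE ?expR_gt0 // ltW.
have h1 : n%:R * L * D <= (t + ln c + L) * D by rewrite ler_wpM2r.
have h2 : k * n.+1%:R <= k + eta / 2 * (t + ln c + L).
  rewrite -natr1 mulrDr mulr1 addrC lerD2l /k.
  rewrite (_ : _ * n%:R = eta / 2 * (n%:R * L)); last by ring.
  by rewrite ler_wpM2l // divr_ge0 // ltW.
by move: tC; rewrite /C'; lra.
Qed.

End BoxDimension.

(** * Covering a graph by slabs over cells *)

(** Over [C i] the graph lies in a column of height [2 * b i], cut into [trunc (2 * b i / eps) + 1]
    slabs of height [eps]; the ones sum to [#|I|]. Quantifying [delta] after [m] lets one count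
    serve all coarser scales. *)
Lemma graph_finite_cover (R : realType) (q : nat) (g : ('I_q -> R) -> R)
    (I : finType) (C : I -> set ('I_q -> R)) (b : I -> R) (eps : R) :
  0 < eps -> cube q `<=` \bigcup_(i in [set: I]) C i ->
  (forall i x y, C i x -> C i y -> forall k, `|x k - y k| <= eps) ->
  (forall i x y, C i x -> C i y -> `|g x - g y| <= b i) ->
  (forall i, 0 <= b i) ->
  exists2 m : nat,
    forall delta, q.+1%:R * eps <= delta ->
      finite_cover R _ (gdist q) (graph q g) delta m &
    m%:R <= #|I|%:R + 2 * eps^-1 * \sum_i b i.
Proof.
move=> eps0 cC Ceps Cb b0.
have /choice [a ha] : forall i, exists a, forall x, C i x -> `|g x - a| <= b i.
  move=> i; have [->|/set0P[z Cz]] := eqVneq (C i) set0; first by exists 0.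
  by exists (g z) => x Cx; exact: Cb.
pose h i := (Num.trunc (2 * b i / eps)).+1.
pose K : finType := {i : I & 'I_(h i)}.
pose U (k : K) : set (('I_q -> R) * R) := [set p | C (tag k) p.1 /\
  let z := a (tag k) - b (tag k) + (tagged k)%:R * eps in z <= p.2 <= z + eps].
exists #|K|.
  move=> delta qd; exists (fun i => U (enum_val i)); split.
    move=> _ [x cx <-]; have [i _ Ci] := cC x cx.
    (* The height above the bottom of the column in units of [eps]; its truncation selects the
       slab. *)
    pose v := (g x - (a i - b i)) / eps.
    have := ha i x Ci; rewrite ler_norml => /andP[lo hi].
    have v0 : 0 <= v by rewrite divr_ge0 ?(ltW eps0) //; lra.
    have vh : (Num.trunc v < h i)%N.
      by rewrite ltnS le_truncn // ler_pM2r ?invr_gt0 //; lra.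
    pose k : K := Tagged (fun i => 'I_(h i)) (Ordinal vh).
    exists (enum_rank k) => //=; rewrite enum_rankK; split => //=.
    have /andP[v1 v2] := truncn_itv v0.
    have ve : v * eps = g x - (a i - b i) by rewrite divfK ?gt_eqF.
    have w1 : (Num.trunc v)%:R * eps <= v * eps by rewrite ler_pM2r.
    have w2 : v * eps <= (Num.trunc v)%:R * eps + eps.
      by rewrite -[X in _ + X]mul1r -mulrDl natr1 ler_pM2r // ltW.
    by apply/andP; split; lra.
  move=> i p p' [Cp zp] [Cp' zp']; apply: le_trans qd.
  apply: gdist_le; [exact: ltW | exact: Ceps Cp Cp' |].
  move: zp zp' => /= /andP[? ?] /andP[? ?].
  by rewrite ler_norml; apply/andP; split; lra.
rewrite card_tagged sumnE big_map big_enum /=.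
under eq_bigr do rewrite card_ord.
rewrite natr_sum -sum1_card natr_sum mulr_sumr -big_split ler_sum // => i _ /=.
rewrite /h -[leLHS]natr1 [leLHS]addrC; apply: lerD => //.
rewrite [leRHS]mulrAC truncn_le.
by rewrite divr_ge0 ?mulr_ge0 // ltW.
Qed.

(** * The uniform partition and oscillations over its cells *)

Section UniformPartition.
Variables (R : realType) (q M : nat).
Hypothesis M_gt1 : (1 < M)%N.

Let M0 : 0 < M%:R :> R. Proof. by rewrite ltr0n ltnW. Qed.

Lemma u1_onto (x : R) : 0 <= x <= 1 ->
  exists (i : 'I_M) y, 0 <= y <= 1 /\ u1 M i.+1 y = x.
Proof.
move=> /andP[x0 x1].
have [i /andP[lo hi]] : exists i : 'I_M, i%:R <= M%:R * x <= i.+1%:R.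
  have Mx0 : 0 <= M%:R * x by rewrite mulr_ge0 // ltW.
  have /andP[t1 t2] := truncn_itv Mx0.
  (* The truncation reaches [M] only at [x = 1], which is put in the last interval. *)
  have [tM|Mt] := ltnP (Num.trunc (M%:R * x)) M.
    by exists (Ordinal tM) => /=; rewrite t1 ltW.
  have pM : (M.-1 < M)%N by rewrite prednK // ltnW.
  exists (Ordinal pM) => /=; rewrite prednK ?(ltnW M_gt1) //.
  have le1 : M%:R * x <= M%:R by rewrite ger_pMr.
  rewrite le1 andbT (le_trans _ t1) // ler_nat.
  exact: leq_trans (leq_pred _) Mt.
exists i, (u1inv M i.+1 x); rewrite /u1 /u1inv; case: (odd _).
  split; first by move: lo hi; rewrite -natr1; lra.
  by rewrite addrC subrK mulrC mulKf // gt_eqF.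
split; first by move: lo hi; rewrite -natr1; lra.
by rewrite opprB addrC subrK mulrC mulKf // gt_eqF.
Qed.

Lemma u_onto (x : 'I_q -> R) : cube q x ->
  exists j, exists2 y, cube q y & u q M j y = x.
Proof.
move=> cx; have /choice [i hi] := fun k => u1_onto (x k) (cx k).
have /choice [y hy] := hi.
exists [ffun k => i k], y; first by move=> k; have [] := hy k.
by apply/funext => k; rewrite /u ffunE; have [] := hy k.
Qed.

Lemma uK (j : {ffun 'I_q -> 'I_M}) : cancel (u (R := R) q M j) (uinv q M j).
Proof.
move=> x; apply/funext => k; rewrite /u /uinv /u1 /u1inv; case: (odd _).
  by field; rewrite gt_eqF.
by field; rewrite gt_eqF.
Qed.

Lemma u_cube (j : {ffun 'I_q -> 'I_M}) (x : 'I_q -> R) :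
  cube q x -> cube q (u q M j x).
Proof.
move=> cx k; have /andP[x0 x1] := cx k; rewrite /u /u1.
have jM : (j k).+1%:R <= M%:R :> R by rewrite ler_nat.
have j0 : 0 <= (j k)%:R :> R by [].
move: jM; rewrite -natr1 => jM.
by case: (odd _); rewrite divr_ge0 ?(ltW M0) ?ler_pdivrMr //=; lra.
Qed.

Lemma u_dist (j : {ffun 'I_q -> 'I_M}) (x y : 'I_q -> R) (k : 'I_q) :
  `|u q M j x k - u q M j y k| = `|x k - y k| / M%:R.
Proof.
rewrite /u /u1 -[X in _ = _ / X](gtr0_norm M0) -normf_div.
case: (odd _); last rewrite distrC.
  by congr (`|_|); field; rewrite gt_eqF.
by congr (`|_|); field; rewrite gt_eqF.
Qed.

Lemma bounded_alpha_bar (alpha : ('I_q -> R) -> R) (a : R) (j : {ffun 'I_q -> 'I_M}) :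
  (forall x, cube q x -> `|alpha x| <= a) ->
  forall x, cube q x -> `|alpha (u q M j x)| <= alpha_bar q M alpha j.
Proof.
move=> aa x cx; apply: ub_le_sup; last by exists (u q M j x) => //; exists x.
by exists a => _ [_ [y cy <-] <-]; exact/aa/u_cube.
Qed.

(** Here [t] stands for [M] to the power [-sig]. Cells of level [n + 1] are the images under all
    [u_j] of those of level [n], so the functional equation applies on each. As [rho] dominates both
    growth rates, each refinement multiplies the sum by at most [rho] and adds at most
    [A * rho ^ n.+1]; hence the factor [n.+1]. *)
Lemma oscillation_cells (f alpha s fa : ('I_q -> R) -> R) (K t rho : R) :
  is_alpha_fractal q M f alpha s fa ->
  (forall x, cube q x -> `|alpha x| <= 1) ->
  0 < K -> 0 < t <= 1 -> 0 < rho ->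
  (forall g, g = f \/ g = alpha \/ g = s -> forall (n : nat) x y,
    cube q x -> cube q y -> (forall k, `|x k - y k| <= M%:R ^- n) ->
    `|g x - g y| <= K * t ^+ n) ->
  \sum_j alpha_bar q M alpha j <= rho -> M%:R ^+ q * t <= rho ->
  exists2 A : R, 0 < A & forall n : nat,
    exists (I : finType) (C : I -> set ('I_q -> R)) (b : I -> R),
      [/\ #|I| = ((M ^ q) ^ n)%N /\ cube q `<=` \bigcup_(i in [set: I]) C i,
          forall i, C i `<=` cube q /\ 0 <= b i,
          forall i x y, C i x -> C i y -> forall k, `|x k - y k| <= M%:R ^- n,
          forall i x y, C i x -> C i y -> `|fa x - fa y| <= b i &
          \sum_i b i <= A * n.+1%:R * rho ^+ n].
Proof.
move=> [cfa fafix] a1 K0 /andP[t0 t1] rho0 hK gam_rho Mt_rho.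
have [B B0 fB] := continuous_on_cube_bounded R q fa cfa.
have cube0 : cube q (fun=> 0 : R) by move=> k; rewrite lexx ler01.
(* A bound for [s]: at [n = 0] the hypothesis [hK] applies to any two points of the cube. *)
pose S := `|s (fun=> 0)| + K.
have sS x : cube q x -> `|s x| <= S.
  move=> cx; have := hK s (or_intror (or_intror erefl)) 0%N x (fun=> 0) cx cube0.
  rewrite expr0 mulr1 invr1 => /(_ _) h.
  have := lerB_dist (s x) (s (fun=> 0)); rewrite /S -lerBlDl => /le_trans -> //.
  apply: h => k; have /andP[x0 x1] := cx k; by rewrite subr0 ger0_norm.
(* The 2 accounts for the variations of [f] and [s], and [B + S] for that of [alpha], which
   multiplies [fa - s]. *)
pose c := K * (2 + B + S).
have S0 : 0 <= S by rewrite addr_ge0 // ltW.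
have c0 : 0 < c by rewrite mulr_gt0 //; lra.
(* [2 * B] is the oscillation at level 0; the other term pays for the error of one refinement. *)
pose A := 2 * B + M%:R ^+ q * c / rho.
have Mq0 : 0 < M%:R ^+ q :> R by rewrite exprn_gt0.
have A0 : 0 < A.
  apply: addr_gt0; first by rewrite mulr_gt0.
  by apply: divr_gt0 => //; exact: mulr_gt0.
exists A => //; elim=> [|n [I [C [b [[cardI cC] Cb Cd Cosc sumb]]]]].
  exists unit, (fun=> cube q), (fun=> 2 * B); split.
  - by split; [rewrite card_unit | move=> x cx; exists tt].
  - by move=> _; split; [move=> x cx | rewrite mulr_ge0 // (ltW B0)].
  - move=> _ x y cx cy k; have := cx k; have := cy k.
    by rewrite expr0 invr1 ler_norml => /andP[? ?] /andP[? ?]; apply/andP; split; lra.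
  - move=> _ x y cx cy; apply: (le_trans (ler_normB _ _)).
    by have := fB x cx; have := fB y cy; lra.
  - rewrite big_const card_unit /= addr0 expr0 !mulr1 /A lerDl.
    by apply: divr_ge0; [apply: mulr_ge0|]; exact: ltW.
have ab0 j : 0 <= alpha_bar q M alpha j.
  exact: le_trans (normr_ge0 _) (bounded_alpha_bar alpha 1 j a1 _ cube0).
exists ({ffun 'I_q -> 'I_M} * I)%type, (fun ji => u q M ji.1 @` C ji.2),
  (fun ji => alpha_bar q M alpha ji.1 * b ji.2 + c * t ^+ n); split.
- split; first by rewrite card_prod card_ffun !card_ord cardI expnS.
  move=> x cx; have [j [y cy <-]] := u_onto x cx.
  by have [i _ Ciy] := cC y cy; exists (j, i) => //; exists y.
- move=> [j i] /=; split; first by move=> _ [y Cy <-]; exact/u_cube/(Cb i).1.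
  apply: addr_ge0; first exact: mulr_ge0 (ab0 j) (Cb i).2.
  by apply: mulr_ge0; [exact: ltW | exact/exprn_ge0/ltW].
- move=> [j i] _ _ [x Cx <-] [y Cy <-] k.
  rewrite u_dist exprSr invfM ler_wpM2r ?invr_ge0 ?(ltW M0) //.
  exact: Cd Cx Cy k.
- move=> [j i] _ _ /= [x Cx <-] [y Cy <-].
  have [cx cy] : cube q x /\ cube q y by split; apply: (Cb i).1.
  have [cux cuy] := (u_cube j x cx, u_cube j y cy).
  have dxy := Cd i x y Cx Cy.
  have duxy k : `|u q M j x k - u q M j y k| <= M%:R ^- n.+1.
    by rewrite u_dist exprSr invfM ler_wpM2r ?invr_ge0 ?(ltW M0).
  (* [f] and [alpha] are compared at scale [n + 1] but [s] at scale [n]; this brings all three to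
     [t ^+ n]. *)
  have tn : t ^+ n.+1 <= t ^+ n by rewrite exprS ler_piMl ?exprn_ge0 // ltW.
  have hf : `|f (u q M j x) - f (u q M j y)| <= K * t ^+ n.
    apply: le_trans (hK f (or_introl erefl) n.+1 _ _ cux cuy duxy) _.
    by rewrite ler_pM2l.
  have hal : `|alpha (u q M j x) - alpha (u q M j y)| <= K * t ^+ n.
    apply: le_trans (hK alpha (or_intror (or_introl erefl)) n.+1 _ _ cux cuy duxy) _.
    by rewrite ler_pM2l.
  have hs : `|s x - s y| <= K * t ^+ n.
    exact: hK s (or_intror (or_intror erefl)) n _ _ cx cy dxy.
  rewrite (fafix j (u q M j x)) ?(fafix j (u q M j y)) ?uK; [|by exists y|by exists x].
  set a := alpha (u q M j x); set a' := alpha (u q M j y).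
  (* Only the term in [fa x - fa y] carries the previous oscillation; the others have order
     [t ^+ n]. *)
  rewrite (_ : _ - _ = (f (u q M j x) - f (u q M j y)) + a * (fa x - fa y)
     + (- a * (s x - s y)) + (a - a') * (fa y - s y)); last by ring.
  have ea : `|a * (fa x - fa y)| <= alpha_bar q M alpha j * b i.
    rewrite normrM ler_pM // ?Cosc //.
    exact: bounded_alpha_bar alpha 1 j a1 x cx.
  have es : `|- a * (s x - s y)| <= K * t ^+ n.
    rewrite normrM normrN -[leRHS]mul1r ler_pM //; exact: a1.
  have ed : `|(a - a') * (fa y - s y)| <= K * t ^+ n * (B + S).
    rewrite normrM ler_pM //; apply: le_trans (ler_normB _ _) _.
    by rewrite lerD ?fB ?sS.
  rewrite (le_trans (ler_normD _ _)) //.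
  have := ler_normD (f (u q M j x) - f (u q M j y) + a * (fa x - fa y)) (- a * (s x - s y)).
  have := ler_normD (f (u q M j x) - f (u q M j y)) (a * (fa x - fa y)).
  move: hf ea es ed; rewrite /c.
  rewrite (_ : K * (2 + B + S) * t ^+ n = K * t ^+ n * (B + S) + 2 * (K * t ^+ n)); last by ring.
  by lra.
- rewrite -(pair_bigA _ (fun j i => alpha_bar q M alpha j * b i + c * t ^+ n)) /=.
  under eq_bigr do rewrite big_split /= -mulr_sumr sumr_const cardI.
  rewrite big_split /= -mulr_suml sumr_const card_ffun !card_ord.
  have h1 : (\sum_j alpha_bar q M alpha j) * \sum_i b i <= rho * (A * n.+1%:R * rho ^+ n).
    by rewrite ler_pM ?sumr_ge0 // => i _; have [] := Cb i.
  apply: le_trans (lerD h1 (lexx _)) _.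
  rewrite (_ : c * _ *+ _ *+ _ = M%:R ^+ q * c * (M%:R ^+ q * t) ^+ n); last first.
    by rewrite -[LHS]mulr_natl -[X in _ * X = _]mulr_natl !natrX exprMn; ring.
  have h2 : (M%:R ^+ q * t) ^+ n <= rho ^+ n.
    by apply: lerXn2r => //; rewrite nnegrE; [apply: mulr_ge0 |]; exact: ltW.
  have h3 : M%:R ^+ q * c * (M%:R ^+ q * t) ^+ n <= A * rho ^+ n.+1.
    rewrite exprS [leRHS]mulrA; apply: ler_pM => //.
    - by apply: mulr_ge0; exact: ltW.
    - by apply/exprn_ge0/mulr_ge0; exact: ltW.
    - rewrite /A mulrDl divfK ?gt_eqF // lerDr.
      by apply: mulr_ge0; [apply: mulr_ge0|]; rewrite // ltW.
  rewrite [leRHS](_ : _ = rho * (A * n.+1%:R * rho ^+ n) + A * rho ^+ n.+1).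
    by rewrite lerD2l.
  by rewrite -(natr1 n.+1) exprS; ring.
Qed.

End UniformPartition.

(** * Common Hölder exponent and the upper bound for the fractal graph *)

(** Brings the three exponents down to their minimum, since for [e <= 1] a smaller exponent gives a
    larger power. Passing from Euclidean to coordinatewise distance costs [q] to the power
    [sig']. *)
Lemma holder_on_cube_scale (R : realType) (q : nat) (g : ('I_q -> R) -> R) (sig sig' : R) :
  (1 <= q)%N -> 0 < sig -> sig <= sig' -> holder_on_cube q g sig' ->
  exists2 K : R, 0 < K & forall (e : R) x y, 0 < e <= 1 -> cube q x -> cube q y ->
    (forall k, `|x k - y k| <= e) -> `|g x - g y| <= K * e `^ sig.
Proof.
move=> q1 s0 ss [K K0 hK].
exists (K * q%:R `^ sig'); first by rewrite mulr_gt0 // powR_gt0 // ltr0n.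
move=> e x y /andP[e0 e1] cx cy xy.
apply: le_trans (hK x y cx cy) _; rewrite -mulrA ler_pM2l //.
apply: (@le_trans _ _ ((q%:R * e) `^ sig')).
  have s0' : 0 <= sig' by rewrite (le_trans (ltW s0)).
  apply: ge0_ler_powR; rewrite ?nnegrE //.
  - exact: sqrtr_ge0.
  - by rewrite mulr_ge0 // ltW.
  - by apply: vdist_le => //; exact: ltW.
rewrite powRM // ?(ltW e0) // ler_wpM2l ?powR_ge0 //.
by rewrite ger_powR // e0.
Qed.

Lemma norm_le_alpha_max (R : realType) (q : nat) (alpha : ('I_q -> R) -> R) (sig : R) :
  (1 <= q)%N -> 0 < sig -> holder_on_cube q alpha sig ->
  forall x, cube q x -> `|alpha x| <= alpha_max q alpha.
Proof.
move=> q1 s0 ha x.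
have [K K0 hK] := holder_on_cube_scale R q alpha sig sig q1 s0 (lexx _) ha.
have cube0 : cube q (fun=> 0 : R) by move=> k; rewrite lexx ler01.
move=> cx; apply: ub_le_sup; last by exists x.
exists (`|alpha (fun=> 0)| + K) => _ [y cy <-].
have : `|alpha y - alpha (fun=> 0)| <= K * 1 `^ sig.
  apply: hK => //; first by rewrite ltr01 lexx.
  by move=> k; have /andP[? ?] := cy k; rewrite subr0 ger0_norm.
by rewrite powR1 mulr1; have := lerB_dist (alpha y) (alpha (fun=> 0)); lra.
Qed.

Section FractalGraph.
Variables (R : realType) (q M : nat) (f alpha s fa : ('I_q -> R) -> R).
Variables (sig sig1 sig2 sig3 : R).
Hypotheses (q_ge1 : (1 <= q)%N) (M_gt1 : (1 < M)%N).
Hypotheses (sig_gt0 : 0 < sig) (sig_le1 : sig <= 1).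
Hypotheses (sig_le : sig <= sig1 /\ sig <= sig2 /\ sig <= sig3).
Hypotheses (hf : holder_on_cube q f sig1) (ha : holder_on_cube q alpha sig2)
  (hs : holder_on_cube q s sig3).
Hypothesis fixpoint : is_alpha_fractal q M f alpha s fa.

Let t : R := M%:R `^ (- sig).
Let M0 : 0 < M%:R :> R. Proof. by rewrite ltr0n ltnW. Qed.
Let t0 : 0 < t. Proof. exact: powR_gt0. Qed.
Let lnM0 : 0 < ln M%:R :> R. Proof. by rewrite ln_gt0 // ltr1n. Qed.

Let cube0 : cube q (fun=> 0 : R).
Proof. by move=> k; rewrite lexx ler01. Qed.

Lemma graph_cover (rho : R) : alpha_max q alpha < 1 ->
  \sum_j alpha_bar q M alpha j <= rho -> M%:R ^+ q * t <= rho ->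
  exists2 C : R, 1 <= C & forall n : nat, exists2 m : nat,
    forall delta, q.+1%:R * M%:R ^- n <= delta ->
      finite_cover R _ (gdist q) (graph q fa) delta m &
    m%:R <= C * n.+1%:R * (M%:R * rho) ^+ n.
Proof.
move=> amax1 gam_rho Mt_rho.
have [Kf Kf0 hKf] := holder_on_cube_scale R q f sig sig1 q_ge1 sig_gt0 sig_le.1 hf.
have [Ka Ka0 hKa] := holder_on_cube_scale R q alpha sig sig2 q_ge1 sig_gt0 sig_le.2.1 ha.
have [Ks Ks0 hKs] := holder_on_cube_scale R q s sig sig3 q_ge1 sig_gt0 sig_le.2.2 hs.
pose K := Kf + Ka + Ks.
have K0 : 0 < K by rewrite /K; lra.
have Mn0 n : 0 < M%:R ^- n :> R by rewrite invr_gt0 exprn_gt0.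
have Mn1 n : M%:R ^- n <= 1 :> R by rewrite invf_le1 ?exprn_gt0 // exprn_ege1 // ler1n ltnW.
have tn n : (M%:R ^- n) `^ sig = t ^+ n.
  rewrite -[in LHS]powR_mulrn ?(ltW M0) // -powRN -powRrM mulNr mulrC -mulNr powRrM.
  by rewrite powR_mulrn // ltW.
have t1 : t <= 1 by rewrite -(powRr0 M%:R) ler_powR ?oppr_le0 ?(ltW sig_gt0) // ler1n ltnW.
have rho0 : 0 < rho by apply: lt_le_trans Mt_rho; rewrite mulr_gt0 ?exprn_gt0.
have a1 x : cube q x -> `|alpha x| <= 1.
  have sig2_gt0 := lt_le_trans sig_gt0 sig_le.2.1.
  by move=> cx; apply: le_trans (norm_le_alpha_max _ _ _ _ q_ge1 sig2_gt0 ha x cx) (ltW amax1).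
have hK g : g = f \/ g = alpha \/ g = s -> forall (n : nat) x y,
    cube q x -> cube q y -> (forall k, `|x k - y k| <= M%:R ^- n) ->
    `|g x - g y| <= K * t ^+ n.
  move=> gE n x y cx cy xy; have e01 : 0 < (M%:R ^- n : R) <= 1.
    by rewrite (Mn0 n) (Mn1 n).
  have p0 : 0 <= t ^+ n by rewrite exprn_ge0 // ltW.
  have [? ? ?] : [/\ Kf <= K, Ka <= K & Ks <= K] by split; rewrite /K; lra.
  case: gE => [->|[->|->]].
  - by apply: le_trans (hKf _ x y e01 cx cy xy) _; rewrite tn ler_wpM2r.
  - by apply: le_trans (hKa _ x y e01 cx cy xy) _; rewrite tn ler_wpM2r.
  - by apply: le_trans (hKs _ x y e01 cx cy xy) _; rewrite tn ler_wpM2r.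
have t01 : 0 < t <= 1 by rewrite t0.
have [A A0 hA] := oscillation_cells R q M M_gt1 f alpha s fa K t rho
  fixpoint a1 K0 t01 rho0 hK gam_rho Mt_rho.
exists (1 + 2 * A); first by rewrite lerDl mulr_ge0 // ltW.
move=> n; have [I [C [b [[cardI cC] Cb Cd Cosc sumb]]]] := hA n.
have [m cm mle] := graph_finite_cover R q fa I C b _ (Mn0 n) cC Cd Cosc (fun i => (Cb i).2).
exists m => //; apply: (le_trans mle); rewrite cardI invrK.
(* Since [sig <= 1] gives [t >= 1 / M], the number of cells is itself at most [(M * rho) ^ n]. *)
have Mrho : M%:R ^+ q <= M%:R * rho.
  rewrite mulrC -ler_pdivrMr //; apply: le_trans Mt_rho.
  rewrite ler_pM2l ?exprn_gt0 // -powR_inv1 ?(ltW M0) // ler_powR ?ler1n ?(ltnW M_gt1) //.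
  by rewrite lerN2.
have h1 : ((M ^ q) ^ n)%N%:R <= n.+1%:R * (M%:R * rho) ^+ n.
  rewrite !natrX -[leLHS]mul1r; apply: ler_pM => //.
  - by rewrite ler1n.
  - by apply: lerXn2r => //; rewrite nnegrE ?exprn_ge0 ?mulr_ge0 ?(ltW M0) ?(ltW rho0).
have h2 : 2 * M%:R ^+ n * \sum_i b i <= 2 * M%:R ^+ n * (A * n.+1%:R * rho ^+ n).
  by rewrite ler_wpM2l // mulr_ge0 // exprn_ge0 // ltW.
apply: le_trans (lerD h1 h2) _; rewrite le_eqVlt; apply/orP; left; apply/eqP.
by rewrite exprMn; ring.
Qed.

(** With [L = ln M] the rate [L * D] is [ln (M * rho)], as [graph_cover] provides. The finite covers
    are returned too, for the comparison with the Hausdorff dimension. *)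
Lemma fractal_graph_dim (rho : R) : alpha_max q alpha < 1 ->
  \sum_j alpha_bar q M alpha j <= rho -> M%:R ^+ q * t <= rho ->
  (forall delta, 0 < delta -> exists n,
    finite_cover R _ (gdist q) (graph q fa) delta n) /\
  (upper_box_dim (gdist q) (graph q fa) <= (1 + ln rho / ln M%:R)%:E)%E.
Proof.
move=> amax1 gam_rho Mt_rho.
have [C C1 hC] := graph_cover rho amax1 gam_rho Mt_rho.
have cov delta : 0 < delta -> exists n, finite_cover R _ (gdist q) (graph q fa) delta n.
  (* [M ^ n >= n >= q.+1 / delta], so the sets of level [n] have diameter at most [delta]. *)
  move=> d0; pose n := (Num.trunc (q.+1%:R / delta)).+1.
  have [m cm _] := hC n; exists m; apply: cm.
  rewrite ler_pdivrMr ?exprn_gt0 // mulrC -ler_pdivrMr //.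
  apply: le_trans (ltW (truncnS_gt _)) _.
  by rewrite -natrX ler_nat; exact/ltnW/ltn_expl.
split=> //.
have rho0 : 0 < rho by apply: lt_le_trans Mt_rho; rewrite mulr_gt0 ?exprn_gt0.
have LD : ln M%:R * (1 + ln rho / ln M%:R) = ln (M%:R * rho).
  by rewrite lnM ?posrE // mulrDr mulr1 mulrC divfK ?gt_eqF.
have G0 : graph q fa !=set0 by exists ((fun=> 0), fa (fun=> 0)); exists (fun=> 0).
apply: (upper_box_dim_le R _ (gdist q) (graph q fa) G0 cov (ln M%:R) _ C q.+1%:R) => //.
(* The exponent is nonnegative because [M * rho >= 1], from [rho >= M ^ q * t >= t >= 1 / M]. *)
- rewrite -(pmulr_rge0 _ lnM0) LD ln_ge0 //.
  rewrite mulrC -ler_pdivrMr // div1r; apply: le_trans Mt_rho.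
  rewrite -[leLHS]mul1r; apply: ler_pM => //.
  + by rewrite exprn_ege1 // ler1n ltnW.
  + by rewrite -powR_inv1 ?(ltW M0) // ler_powR ?ler1n ?(ltnW M_gt1) // lerN2.
- by rewrite ler1n.
move=> n delta; have [m cm mle] := hC n.
rewrite -(mulrA n%:R (ln _)) LD expRN !expRM_natl !lnK ?posrE ?mulr_gt0 //.
by move=> /cm /covering_number_le /le_trans; exact.
Qed.

End FractalGraph.

(** * The three cases *)

Theorem theorem4p7 (R : realType) (q M : nat) (f alpha s fa : ('I_q -> R) -> R)
    (sig1 sig2 sig3 : R) :
  (1 <= q)%N -> (2 <= M)%N ->
  0 < sig1 <= 1 -> 0 < sig2 <= 1 -> 0 < sig3 <= 1 ->
  holder_on_cube q f sig1 -> holder_on_cube q alpha sig2 -> holder_on_cube q s sig3 ->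
  alpha_max q alpha < 1 ->
  (forall x, vertex q x -> s x = f x) ->
  is_alpha_fractal q M f alpha s fa ->
  let sig := Num.min sig1 (Num.min sig2 sig3) in
  let gam := \sum_(j : {ffun 'I_q -> 'I_M}) alpha_bar q M alpha j in
  let G := graph q fa in
  let chain (b : R) :=
    [/\ (q%:R%:E <= hausdorff_dim (gdist q) G)%E,
        (hausdorff_dim (gdist q) G <= lower_box_dim (gdist q) G)%E,
        (lower_box_dim (gdist q) G <= upper_box_dim (gdist q) G)%E &
        (upper_box_dim (gdist q) G <= b%:E)%E] in
  [/\ powR M%:R (- sig) < alpha_min q alpha ->
        chain (1 + ln gam / ln M%:R),
      powR M%:R (- sig) < alpha_max q alpha < 1 ->
        chain (q%:R + 1 + ln (alpha_max q alpha) / ln M%:R) &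
      alpha_max q alpha <= powR M%:R (- sig) ->
        chain (q%:R + 1 - sig)].
Proof.
move=> q1 M2 /andP[s1 s11] /andP[s2 _] /andP[s3 _] hf ha hs amax1 _ fixp sig gam G chain.
have sig0 : 0 < sig by rewrite !lt_min s1 s2.
have sig1' : sig <= 1 by rewrite !ge_min s11.
have sle : sig <= sig1 /\ sig <= sig2 /\ sig <= sig3.
  by rewrite !ge_min !lexx /= !orbT.
have M0 : 0 < M%:R :> R by rewrite ltr0n ltnW.
have lnM0 : 0 < ln M%:R :> R by rewrite ln_gt0 // ltr1n.
have Mq0 : 0 < M%:R ^+ q :> R by rewrite exprn_gt0.
have cube0 : cube q (fun=> 0 : R) by move=> k; rewrite lexx ler01.
pose t : R := M%:R `^ (- sig).
have t0 : 0 < t by exact: powR_gt0.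
have amax x (cx : cube q x) : `|alpha x| <= alpha_max q alpha :=
  norm_le_alpha_max R q alpha sig2 q1 s2 ha x cx.
have key rho : gam <= rho -> M%:R ^+ q * t <= rho -> chain (1 + ln rho / ln M%:R).
  move=> gr tr.
  have [cov ub] := fractal_graph_dim R q M f alpha s fa sig sig1 sig2 sig3 q1 M2
    sig0 sig1' sle hf ha hs fixp rho amax1 gr tr.
  split => //; first exact: hausdorff_dim_graph_ge.
    apply: hausdorff_dim_le_lower_box => //; first by move=> p p'; exact: sqrtr_ge0.
    by exists ((fun=> 0), fa (fun=> 0)); exists (fun=> 0).
  exact: lower_box_dim_le_upper.
have card_sum (a : R) : M%:R ^+ q * a = \sum_(j : {ffun 'I_q -> 'I_M}) a.
  by rewrite sumr_const card_ffun !card_ord -natrX mulr_natl.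
have gam_le : gam <= M%:R ^+ q * alpha_max q alpha.
  rewrite card_sum; apply: ler_sum => j _; apply: ge_sup.
    by exists `|alpha (u q M j (fun=> 0))|, (u q M j (fun=> 0)); first exists (fun=> 0).
  by move=> _ [_ [y cy <-] <-]; apply/amax/u_cube.
have ln_bound (a : R) : 0 < a ->
    1 + ln (M%:R ^+ q * a) / ln M%:R = q%:R + 1 + ln a / ln M%:R.
  move=> a0; rewrite lnM ?posrE // lnXn // -[_ *+ q]mulr_natl.
  by rewrite mulrDl mulfK ?gt_eqF //; ring.
split.
(* Each of the [M ^ q] numbers [alpha_bar j] is at least [alpha_min], hence above [t], so
   [gam >= M ^ q * t]. *)
- move=> amin; apply: key => //; rewrite card_sum; apply: ler_sum => j _.
  apply: le_trans (ltW amin) _.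
  apply: (@le_trans _ _ `|alpha (u q M j (fun=> 0))|).
    apply: ge_inf; first by exists 0 => _ [x _ <-].
    by exists (u q M j (fun=> 0)) => //; exact: u_cube.
  exact: (bounded_alpha_bar R q M M2 alpha _ j amax).
- move=> /andP[ta _]; rewrite -ln_bound; last exact: lt_trans ta.
  by apply: key => //; rewrite ler_pM2l //; exact: ltW.
(* Here [gam <= M ^ q * alpha_max <= M ^ q * t], and [ln t / ln M = - sig]. *)
- move=> ta; have -> : q%:R + 1 - sig = 1 + ln (M%:R ^+ q * t) / ln M%:R.
    by rewrite ln_bound // ln_powR mulfK // gt_eqF.
  by apply: key => //; apply: le_trans gam_le _; rewrite ler_pM2l.
Qed.
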